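(* Let $U$ be compact, let $(X,\mathcal{S},m)$ be a finite measure space, let the observables of interest $\boldsymbol{g}=(g_1,\dots,g_{N_y})$ satisfy $g_j \in C_b(X)$ for $j=1,\dots,N_y$, and suppose that $\boldsymbol{f}(\boldsymbol{x},\cdot): U \to X$ is continuous for $m$-a.e. $\boldsymbol{x} \in X$. Then, for any $\varepsilon > 0$, there exist a positive integer $N_\psi$, a dictionary $\boldsymbol{\Psi} = (\psi_1,\dots,\psi_{N_\psi})^T$ with $\psi_i \in L^2(X,m)$, a set of vectors $\{\boldsymbol{a}_{j} \in \mathbb{R}^{N_{\psi}}: j=1,\dots,N_y\}$, and a continuous function $K : U \to \mathbb{R}^{N_\psi \times N_\psi}$ such that $g_j = \boldsymbol{a}_j^T \boldsymbol{\Psi}$ for all $j=1,\dots,N_y$, and for all $\boldsymbol{u} \in U$ and all $j=1,\dots,N_y$, $$\|\mathcal{K}(\boldsymbol{u})g_{j} - \boldsymbol{a}_{j}^{T}K(\boldsymbol{u})\boldsymbol{\Psi}\|_{L^2(X,m)}\leq \varepsilon.$$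
   Context: Setting: $X \subseteq \mathbb{R}^{N_x}$, $\mathcal{S}$ is the Borel $\sigma$-algebra of $X$, and $m$ is a finite measure on $(X,\mathcal{S})$. $U \subseteq \mathbb{R}^{N_u}$ is a set of parameters, and $\{\boldsymbol{f}(\cdot,\boldsymbol{u}) : \boldsymbol{u}\in U\}$ is a family of (measurable) transformations $X\to X$. $L^2(X,m)$ is the space of real-valued square-integrable functions on $X$ with norm $\|\phi\|=\left(\int_X \phi^2\, dm\right)^{1/2}$; $C_b(X)$ is the space of continuous bounded real-valued functions on $X$ (so $C_b(X)\subset L^2(X,m)$). For each $\boldsymbol{u}\in U$, the parametric Koopman operator $\mathcal{K}(\boldsymbol{u}): L^2(X,m)\to L^2(X,m)$ is defined by $\mathcal{K}(\boldsymbol{u})\phi(\boldsymbol{x}) = \phi(\boldsymbol{f}(\boldsymbol{x},\boldsymbol{u}))$. Standing assumptions: for every $\boldsymbol{u}\in U$, $\boldsymbol{f}(\cdot,\boldsymbol{u})$ is non-singular, i.e. for $S\in\mathcal{S}$, $m(\boldsymbol{f}(\cdot,\boldsymbol{u})^{-1}(S))=0$ whenever $m(S)=0$; and for every $\boldsymbol{u}\in U$ there exists $b_{\boldsymbol{u}}>0$ such that $m(\boldsymbol{f}(\cdot,\boldsymbol{u})^{-1}(S))\le b_{\boldsymbol{u}}\, m(S)$ for every $S\in\mathcal{S}$. Thus each $\mathcal{K}(\boldsymbol{u})$ is a well-defined bounded linear operator on $L^2(X,m)$. Continuity of $K$ is with respect to any norm (e.g. Frobenius) on matrices. *)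

(* Defs.v *)
From HB Require Import structures.
From mathcomp Require Import all_boot all_order all_algebra.
From mathcomp Require Import all_classical all_reals all_analysis.

Set Implicit Arguments.
Unset Strict Implicit.
Unset Printing Implicit Defensive.

Import Order.TTheory GRing.Theory Num.Theory.
Import numFieldNormedType.Exports.

Local Open Scope classical_set_scope.
Local Open Scope ring_scope.

(* A nonempty subset X of a topological space, as a type carrying both the
   subspace topology and its Borel sigma-algebra. Nonemptiness is required only
   because a measurableType is pointed; the chosen point is otherwise
   irrelevant. *)
Definition borel_subset {T : topologicalType} {X : set T} (X0 : X !=set0) :
  Type := set_type X.

Section borel_subset_instances.
Context {T : topologicalType} {X : set T} (X0 : X !=set0).

HB.instance Definition _ := Topological.copy (borel_subset X0) (set_type X).
HB.instance Definition _ := isPointed.Build (borel_subset X0)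
  (SigSub (mem_set (svalP (cid X0)))).
HB.instance Definition _ := Measurable.copy (borel_subset X0)
  (g_sigma_algebraType (@open (borel_subset X0))).

End borel_subset_instances.

Section nonsingular_maps.
Context {d : measure_display} {T : measurableType d} {R : realType}.

Definition nonsingular (m : {measure set T -> \bar R}) (h : T -> T) : Prop :=
  forall S, measurable S -> m S = 0%E -> m (h @^-1` S) = 0%E.

Definition preimage_bounded (m : {measure set T -> \bar R}) (h : T -> T) :
  Prop :=
  exists2 b : R, 0 < b &
    forall S, measurable S -> (m (h @^-1` S) <= b%:E * m S)%E.

End nonsingular_maps.

(* Acts on representatives; nonsingularity of f(., u) makes it compatible with
   almost-everywhere equality, hence well defined on L^2 classes. *)
Definition koopman {T V W : Type} (f : T -> V -> T) (u : V) (phi : T -> W) :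
  T -> W := fun x => phi (f x u).

Definition row_dict {T : Type} {R : nzRingType} {n : nat}
    (c : 'rV[R]_n) (Psi : 'I_n -> T -> R) : T -> R :=
  fun x => (c *m \col_i Psi i x) 0 0.

(* Main.v *)
Require Import Defs.
From HB Require Import structures.
From mathcomp Require Import all_boot all_order all_algebra.
From mathcomp Require Import all_classical all_reals all_analysis.
From mathcomp Require Import measurable_realfun ring.

Set Implicit Arguments.
Unset Strict Implicit.
Unset Printing Implicit Defensive.

Import Order.TTheory GRing.Theory Num.Theory.
Import numFieldNormedType.Exports.

Local Open Scope classical_set_scope.
Local Open Scope ring_scope.

(** Write T(u) for the Koopman operator, as opposed to the matrix K(u). The map
    u |-> T(u) g_j from U to L^2 is continuous: for almost every x the
    value g_j (f x u) depends continuously on u, and these values are bounded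
    uniformly, so dominated convergence applies on the finite measure space.
    Since U is compact, finitely many parameters w_1, ..., w_n have the property
    that every T(u) g_j is eps-close, for all j at once, to some T(w_k) g_j. A
    continuous partition of unity lam_1, ..., lam_n subordinate to the
    corresponding cover of U then gives
      || T(u) g_j - sum_k lam_k(u) T(w_k) g_j || <= eps,
    because the right-hand member is a convex combination of functions that
    are all eps-close to T(u) g_j (weights at the others vanish).

    This is already of the required form. The dictionary consists of the
    observables g_j together with all the functions T(w_k) g_j; the vector a_j
    selects g_j, and the row of the matrix K(u) indexed by g_j carries the weight
    lam_k(u) in the column indexed by T(w_k) g_j, all other entries being 0.
    Thus a_j^T K(u) Psi is the convex combination above, and the entries of
    K(u) are continuous because the weights are.

    The proof works with squared norms: the squared distance is an
    integral of a bounded integrand ([continuous_Rintegral]), and the convexity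
    of balls reduces to the convexity of the square
    ([sqr_convex_combination], [Lnorm2_convex_combination]). The weights come
    from [compact_partition_of_unity]. *)

(** * Continuity of integrals depending on a parameter *)

(** Balls of radius 1 / (n + 1) form a countable neighbourhood basis; this lets
    dominated convergence, a statement about sequences, yield continuity. *)
Lemma cvg_seq_pseudoMetric (R : realType) (V : pseudoMetricType R)
    (W : topologicalType) (F : V -> W) (p : V) :
  (forall u : nat -> V, u n @[n --> \oo] --> p ->
    F (u n) @[n --> \oo] --> F p) ->
  {for p, continuous F}.
Proof.
move=> Fseq A FA; apply: contrapT => nA.
have /choice[u u_spec] : forall n, exists v : V,
    ball p n.+1%:R^-1 v /\ ~ A (F v).
  move=> n; apply: contrapT => none; apply: nA; apply/nbhs_ballP.
  exists n.+1%:R^-1 => //= v pv.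
  by apply: contrapT => nAFv; apply: none; exists v.
have u_p : u n @[n --> \oo] --> p.
  apply/cvg_ballP => e e0; near=> n.
  apply: (@le_ball _ _ p n.+1%:R^-1); last by case: (u_spec n).
  by apply: ltW; near: n; exact: (near_infty_natSinv_lt (PosNum e0)).
have [n _ /(_ n (leqnn n)) /=] := Fseq u u_p A FA.
by case: (u_spec n).
Unshelve. all: by end_near. Qed.

(** The constant bound is integrable since the measure is finite, so it serves
    as the dominating function along every sequence of parameters. *)
Lemma continuous_Rintegral (d : measure_display) (T : measurableType d)
    (R : realType) (m : {finite_measure set T -> \bar R})
    (V : pseudoMetricType R) (H : V -> T -> R) (M : R) :
  (forall u, measurable_fun setT (H u)) ->
  (forall u x, `|H u x| <= M) ->
  {ae m, forall x, continuous (H^~ x)} ->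
  continuous (fun u => \int[m]_x H u x).
Proof.
move=> mH bH cH u; apply: cvg_seq_pseudoMetric => v vu.
have mHE w : measurable_fun setT (fun x => (H w x)%:E) by apply/measurable_EFinP.
have [|||intH _ cvgH] := @dominated_convergence _ _ _ m _ measurableT
    (fun n => EFin \o H (v n)) (EFin \o H u) (cst M%:E) (fun n => mHE (v n))
    (mHE u).
- apply: filterS cH => x Hx _; apply: cvg_EFin; first exact: nearW.
  exact: (continuous_cvg _ (Hx u)).
- exact: finite_measure_integrable_cst.
- by apply: aeW => x n _; rewrite /= lee_fin.
apply: fine_cvg; rewrite fineK; first exact: cvgH.
exact: integrable_fin_num.
Qed.

(** * Partitions of unity on a compact set *)

(** Open sets of the subspace are traces of open sets of the ambient space, where
    compactness of A is used. *)
Lemma compact_finite_subcover (V : ptopologicalType) (A : set V)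
    (O : set_type A -> set (set_type A)) :
  compact A -> (forall u, open (O u)) -> (forall u, O u u) ->
  exists s : seq (set_type A), forall v, exists2 u, u \in s & O u v.
Proof.
move=> cA oO Ouu.
have /choice[B OB] : forall u, exists B : set V, open B /\ set_val @^-1` B = O u.
  by move=> u; have [B oB BO] := oO u; exists B.
move: cA; rewrite compact_cover.
move=> /(_ _ setT B) [u _||s _ sA]; first by case: (OB u).
  move=> x Ax; exists (exist _ x (mem_set Ax)) => //.
  by have := Ouu (exist _ x (mem_set Ax)); rewrite -(OB _).2.
exists (finmap.enum_fset s) => v; have [u us Buv] := sA _ (set_valP v).
by exists u => //; rewrite -(OB u).2.
Qed.

(** The function d plays the role of a distance, so the sets {u | d u v < e} are
    open neighbourhoods of the points v; normalizing the bumps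
    max(0, e - d u w_k) of a finite subcover gives the weights. *)
Lemma compact_partition_of_unity (R : realType) (V : ptopologicalType)
    (A : set V) (d : set_type A -> set_type A -> R) (e : R) :
  compact A -> (forall v, continuous (d^~ v)) -> (forall v, d v v < e) ->
  exists (n : nat) (w : 'I_n -> set_type A) (lam : 'I_n -> set_type A -> R),
    [/\ forall k, continuous (lam k),
        forall k u, 0 <= lam k u,
        forall u, \sum_k lam k u = 1 &
        forall k u, lam k u != 0 -> d u (w k) < e].
Proof.
move=> cA cd dvv.
have [|//|s s_cover] := @compact_finite_subcover _ _
    (fun v => [set u | d u v < e]) cA.
  by move=> v; have /continuousP/(_ _ (@open_lt _ e)) := cd v.
pose w (k : 'I_(size s)) := tnth (in_tuple s) k.
pose b k u := Num.max 0 (e - d u (w k)).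
have b_ge0 k u : 0 <= b k u by rewrite le_max lexx.
have b_gt0 k u : (0 < b k u) = (d u (w k) < e).
  by rewrite lt_max ltxx subr_gt0.
have cb k : continuous (b k).
  move=> u; apply: (@continuous_max _ _ (cst 0) (fun v => e - d v (w k))).
    exact: cst_continuous.
  by apply: continuousB; [exact: cst_continuous|exact: cd].
pose S u := \sum_k b k u.
have S_gt0 u : 0 < S u.
  have [v vs duv] := s_cover u.
  have /tnthP[k vk] : v \in in_tuple s by [].
  rewrite /S (bigD1 k)//= ltr_pwDl ?sumr_ge0//.
  by rewrite b_gt0 /w -vk.
have cS : continuous S.
  by apply: continuous_big => //; exact: add_continuous.
exists (size s), w, (fun k u => b k u / S u); split => [k u|k u|u|k u].
- apply: continuousM; first exact: cb.
  by apply: continuousV; [rewrite gt_eqF|exact: cS].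
- by rewrite divr_ge0// ltW.
- by rewrite -mulr_suml -/(S u) divff// lt0r_neq0.
- apply: contraR; rewrite -b_gt0 lt0r b_ge0 andbT negbK => /eqP ->.
  by rewrite mul0r.
Qed.

(** * Convex combinations in L^2 of a finite measure *)

(** With c the mean of the s_k, the difference of the two sides is the variance
    sum_k lam_k (c - s_k)^2. *)
Lemma sqr_convex_combination (R : realDomainType) (n : nat)
    (lam s : 'I_n -> R) (t : R) :
  (forall k, 0 <= lam k) -> \sum_k lam k = 1 ->
  (t - \sum_k lam k * s k) ^+ 2 <= \sum_k lam k * (t - s k) ^+ 2.
Proof.
move=> lam0 lam1; set c := \sum_k lam k * s k.
rewrite -subr_ge0.
have -> : \sum_k lam k * (t - s k) ^+ 2 - (t - c) ^+ 2 =
    \sum_k lam k * (c - s k) ^+ 2.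
  under eq_bigr => k _.
    rewrite (_ : lam k * _ = (t ^+ 2 - c ^+ 2) * lam k
      - (2 * (t - c)) * (lam k * s k) + lam k * (c - s k) ^+ 2); last by ring.
    over.
  rewrite big_split/= sumrB -!mulr_sumr lam1 -/c; ring.
by apply: sumr_ge0 => k _; rewrite mulr_ge0// sqr_ge0.
Qed.

Section finite_measure_L2.
Context {d : measure_display} {T : measurableType d} {R : realType}.
Variable m : {finite_measure set T -> \bar R}.

Lemma bounded_integrable (h : T -> R) (M : R) :
  measurable_fun setT h -> (forall x, `|h x| <= M) ->
  m.-integrable setT (EFin \o h).
Proof.
move=> mh hM; apply: measurable_bounded_integrable => //.
  by rewrite ltey_eq fin_num_measure.
by exists M; split=> [|N MN x _]; [exact: num_real|exact: le_trans (hM x) (ltW MN)].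
Qed.

Lemma Lnorm2_le (h : T -> R) (e : R) :
  0 <= e -> (\int[m]_x (h x ^+ 2)%:E <= (e ^+ 2)%:E)%E ->
  (Lnorm m 2%:E (EFin \o h) <= e%:E)%E.
Proof.
move=> e0 he; rewrite unlock /=.
under eq_integral => x _ do rewrite /= powR_mulrn// real_normK ?num_real//.
have -> : e%:E = ((e ^+ 2)%:E `^ 2^-1)%E.
  by rewrite poweR_EFin -powR_mulrn// -powRrM mulfV ?pnatr_eq0// powRr1.
apply: gt0_ler_poweR => //.
- by rewrite in_itv/= leey andbT integral_ge0// => x _; rewrite lee_fin sqr_ge0.
- by rewrite in_itv/= leey andbT lee_fin sqr_ge0.
Qed.

Lemma bounded_Lfun2 (h : T -> R) (M : R) :
  measurable_fun setT h -> (forall x, `|h x| <= M) -> h \in Lfun m 2%:E.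
Proof.
move=> mh hM; rewrite inE; apply/andP; split; rewrite inE//=.
rewrite /finite_norm unlock poweR_lty//.
under eq_integral => x _ do rewrite /= powR_mulrn// real_normK ?num_real//.
apply: integrable_lty => //.
apply: (@bounded_integrable (fun x => h x ^+ 2) (M ^+ 2)).
  exact: measurable_funX.
by move=> x; rewrite normrX lerXn2r ?nnegrE// (le_trans _ (hM x)).
Qed.

(** Balls of L^2 are convex. Only the s_k of nonzero weight have to lie in the
    ball, which is what a subordinate partition of unity provides. *)
Lemma Lnorm2_convex_combination (n : nat) (lam : 'I_n -> R) (h : T -> R)
    (s : 'I_n -> T -> R) (M e : R) :
  measurable_fun setT h -> (forall k, measurable_fun setT (s k)) ->
  (forall x, `|h x| <= M) -> (forall k x, `|s k x| <= M) ->
  0 <= e -> (forall k, 0 <= lam k) -> \sum_k lam k = 1 ->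
  (forall k, lam k != 0 -> \int[m]_x ((h x - s k x) ^+ 2) <= e ^+ 2) ->
  (Lnorm m 2%:E (EFin \o (h \- (fun x => \sum_k lam k * s k x))%R) <= e%:E)%E.
Proof.
move=> mh ms hM sM e0 lam0 lam1 hs.
have mhs k : measurable_fun setT (fun x => (h x - s k x) ^+ 2).
  by apply: measurable_funX; exact: measurable_funB.
have ihs k : m.-integrable setT (EFin \o (fun x => (h x - s k x) ^+ 2)).
  apply: (@bounded_integrable _ ((M + M) ^+ 2)) => // x.
  rewrite normrX lerXn2r ?nnegrE// ?(le_trans (ler_normB _ _)) ?lerD//.
  by rewrite addr_ge0// (le_trans _ (hM x)).
have mc : measurable_fun setT (fun x => \sum_k lam k * s k x).
  by apply: measurable_sum => k; exact: measurable_funM.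
apply: Lnorm2_le => //.
apply: (@le_trans _ _ (\int[m]_x \sum_k (lam k)%:E * ((h x - s k x) ^+ 2)%:E)%E).
  apply: ge0_le_integral => //.
  - by move=> x _; rewrite lee_fin sqr_ge0.
  - by apply/measurable_EFinP/measurable_funX/measurable_funB.
  - apply: emeasurable_sum => k; apply: emeasurable_funM => //.
    exact/measurable_EFinP.
  - move=> x _; under eq_bigr do rewrite -EFinM.
    by rewrite sumEFin lee_fin sqr_convex_combination.
rewrite integral_sum//; last first.
  by move=> k; exact: (integrableZl measurableT (lam k) (ihs k)).
under eq_bigr => k _.
  rewrite (integralZl measurableT (ihs k)) -[X in (_ * X)%E]fineK; last first.
    exact: integrable_fin_num.
  rewrite -EFinM; over.
rewrite sumEFin lee_fin -[leRHS]mul1r -lam1 mulr_suml.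
apply: ler_sum => k _.
have [->|lk0] := eqVneq (lam k) 0; first by rewrite !mul0r.
by rewrite ler_wpM2l// hs.
Qed.

End finite_measure_L2.

(** * Borel functions, matrix-valued maps and dictionary combinations *)

Lemma continuous_borel_measurable (T : topologicalType) (X : set T)
    (X0 : X !=set0) (R : realType) (g : borel_subset X0 -> R) :
  continuous g -> measurable_fun setT g.
Proof.
move=> /continuousP cg; apply: (measurability _ (RGenOpens.measurableE R)).
move=> _ [_ [a [b ->] <-]]; rewrite setTI.
by apply: sub_sigma_algebra; exact/cg/interval_open.
Qed.

Lemma continuous_matrix (T V : topologicalType) (p q : nat)
    (K : T -> 'M[V]_(p, q)) :
  (forall i j, continuous (fun u => K u i j)) -> continuous K.
Proof.
move=> cK u A [P PK PA].
have : \forall v \near u, forall i j, P i j (K v i j).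
  apply: filter_forall => i; apply: filter_forall => j.
  exact: (cK i j u _ (PK i j)).
by apply: filterS => v; exact: PA.
Qed.

Section row_dict.
Context {T : Type} {R : nzRingType} {n : nat}.
Implicit Types (Psi : 'I_n -> T -> R) (x : T).

Lemma row_dict_delta (i : 'I_n) Psi x :
  row_dict (delta_mx 0 i) Psi x = Psi i x.
Proof. by rewrite /row_dict -rowE !mxE. Qed.

Lemma row_dict_delta_mul (i : 'I_n) (A : 'M[R]_n) Psi x :
  row_dict (delta_mx 0 i *m A) Psi x = \sum_j A i j * Psi j x.
Proof.
by rewrite /row_dict -rowE mxE; apply: eq_bigr => j _; rewrite !mxE.
Qed.

End row_dict.

(** * The approximation theorem *)

Theorem proposition3p1 (R : realType) (Nx Nu Ny : nat)
    (X : set 'rV[R]_Nx) (X0 : X !=set0)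
    (m : {finite_measure set (borel_subset X0) -> \bar R})
    (U : set 'rV[R]_Nu)
    (f : borel_subset X0 -> set_type U -> borel_subset X0)
    (g : 'I_Ny -> borel_subset X0 -> R)
    (f_measurable : forall u : set_type U, measurable_fun setT (f^~ u))
    (f_nonsingular : forall u : set_type U, nonsingular m (f^~ u))
    (f_bounded : forall u : set_type U, preimage_bounded m (f^~ u))
    (U_compact : compact U)
    (g_continuous : forall j, continuous (g j))
    (g_bounded : forall j, bounded_fun (g j))
    (f_continuous : {ae m, forall x, continuous (f x)})
    (eps : R) (eps_gt0 : 0 < eps) :
  exists (Npsi : nat) (Psi : 'I_Npsi -> borel_subset X0 -> R)
         (a : 'I_Ny -> 'cV[R]_Npsi) (K : set_type U -> 'M[R]_Npsi),
    [/\ (0 < Npsi)%N,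
        forall i, Psi i \in Lfun m 2%:E,
        continuous K,
        forall j, ae_eq m setT (g j) (row_dict (a j)^T Psi)
      & forall (u : set_type U) (j : 'I_Ny),
          (Lnorm m 2%:E (EFin \o
             (koopman f u (g j) \- row_dict ((a j)^T *m K u) Psi)%R)
           <= eps%:E)%E].
Proof.
have mg j : measurable_fun setT (g j) by exact: continuous_borel_measurable.
have mgf u j : measurable_fun setT (koopman f u (g j)).
  exact: measurableT_comp (mg j) (f_measurable u).
have /choice[M gM] : forall j, exists M, forall x, `|g j x| <= M.
  move=> j; have [M [_ gM]] := g_bounded j.
  by exists (M + 1) => x; apply: gM => //; rewrite ltrDl.
have M_ge0 j : 0 <= M j by rewrite (le_trans _ (gM j point)).
(* Squared L^2 distances, whose continuity is that of a single integral. *)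
pose D j u v := \int[m]_x ((koopman f u (g j) x - koopman f v (g j) x) ^+ 2).
have D_ge0 j u v : 0 <= D j u v.
  by apply: Rintegral_ge0 => x _; rewrite sqr_ge0.
have cD j v : continuous ((D j)^~ v).
  apply: (@continuous_Rintegral _ _ _ m _ _ ((M j + M j) ^+ 2)).
  - by move=> u; apply: measurable_funX; exact: measurable_funB.
  - move=> u x; rewrite normrX lerXn2r ?nnegrE ?addr_ge0//.
    by apply: le_trans (ler_normB _ _) _; rewrite lerD//; exact: gM.
  - apply: filterS f_continuous => x cfx u.
    apply: (@continuous_comp _ _ _ (fun w => koopman f w (g j) x - _)
      (fun y => y ^+ 2)); last exact: exprn_continuous.
    apply: continuousB; last exact: cst_continuous.
    exact: (@continuous_comp _ _ _ (f x) (g j) _ (cfx u) (@g_continuous j _)).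
(* Summing over j makes one partition of unity serve all observables. *)
pose d u v := \sum_j D j u v.
have d_diag v : d v v < eps ^+ 2.
  rewrite /d big1 ?exprn_gt0// => j _.
  rewrite /D (_ : (fun x => _) = cst 0) ?Rintegral_cst ?mul0r//.
  by apply/funext => x; rewrite subrr expr0n.
have cd v : continuous (d^~ v).
  by apply: continuous_big => //; exact: add_continuous.
have [n [w [lam [lam_cont lam_ge0 lam_sum lam_d]]]] :=
  compact_partition_of_unity U_compact cd d_diag.
(* Dictionary indices: g_j is inr (inl j) and koopman f (w k) (g j) is inr (inr (k, j)).
   The zero function at inl tt keeps the dictionary nonempty when there are no
   observables. *)
pose I : finType := (unit + ('I_Ny + 'I_n * 'I_Ny))%type.
pose psi (i : I) : borel_subset X0 -> R :=
  match i with
  | inl _ => cst 0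
  | inr (inl j) => g j
  | inr (inr (k, j)) => koopman f (w k) (g j)
  end.
pose kappa u (i i' : I) : R :=
  match i, i' with
  | inr (inl j), inr (inr (k, j')) => if j' == j then lam k u else 0
  | _, _ => 0
  end.
have kappa_cont i i' : continuous (fun u => kappa u i i').
  case: i => [t|[j|[k j]]]; case: i' => [t'|[j'|[k' j']]];
    rewrite /kappa; try by move=> ?; exact: cst_continuous.
  by case: eqP => _ u; [exact: lam_cont|exact: cst_continuous].
pose iota j : 'I_#|I| := enum_rank (inr (inl j) : I).
exists #|I|, (fun p => psi (enum_val p)), (fun j => delta_mx (iota j) 0),
  (fun u => \matrix_(p, q) kappa u (enum_val p) (enum_val q)).
split.
- by apply/card_gt0P; exists (inl tt).
- move=> p; case: (enum_val p) => [_|[j|[k j]]] /=.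
  + exact: Lfun_cst.
  + exact: bounded_Lfun2 (mg j) (gM j).
  + by apply: bounded_Lfun2 (mgf (w k) j) _ => x; exact: gM.
- apply: continuous_matrix => p q.
  by under eq_fun do rewrite mxE; exact: kappa_cont.
- move=> j; apply: aeW => x _.
  by rewrite trmx_delta row_dict_delta enum_rankK.
- move=> u j.
  rewrite (_ : row_dict _ _ =
      fun x => \sum_k lam k u * koopman f (w k) (g j) x); last first.
    apply/funext => x; rewrite trmx_delta row_dict_delta_mul.
    under eq_bigr => q _ do rewrite mxE enum_rankK.
    rewrite -(big_enum_val (fun i => kappa u (inr (inl j)) i * psi i x))/=.
    rewrite !big_sumType/= [X in X + _]big1 ?add0r; last first.
      by move=> t _; rewrite mul0r.
    rewrite [X in X + _]big1 ?add0r; last by move=> j' _; rewrite mul0r.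
    rewrite (eq_big xpredT (fun p => if p.2 == j
      then lam p.1 u * koopman f (w p.1) (g j) x else 0)) //=; last first.
      by case=> k j' _ /=; case: eqP => [->|_]; rewrite ?mul0r.
    rewrite -(pair_bigA _ (fun k j' => if j' == j
      then lam k u * koopman f (w k) (g j) x else 0))/=.
    by apply: eq_bigr => k _; rewrite -big_mkcond big_pred1_eq.
  apply: (@Lnorm2_convex_combination _ _ _ m n (lam^~ u) _ _ (M j)) => //.
  + by move=> x; exact: gM.
  + by move=> k x; exact: gM.
  + exact: ltW.
  + move=> k /lam_d; rewrite /d (bigD1 j)//= => /ltW; apply: le_trans.
    by rewrite lerDl sumr_ge0.
Qed.
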